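(* Let $d\geqslant 4$ be an even integer and let $r$ be an integer with $\gcd(d,r)=1$. Let $n>1$ be an integer with $n\equiv -r\pmod{d}$ and $n\geqslant \max\{r,d-r\}$. Then \[ \sum_{k=0}^{n-1}[2dk+r]\frac{(q^r;q^d)_k^d}{(q^d;q^d)_k^d}q^{\frac{d(d-r-2)k}{2}} \equiv 0\pmod{\Phi_n(q)^2}. \]
   Context: $q$ is an indeterminate. The $q$-shifted factorial is $(a;q)_k=(1-a)(1-aq)\cdots(1-aq^{k-1})$ (with $(a;q)_0=1$), for any Laurent monomial $a$ in $q$. For any integer $m$ (including negative $m$), $[m]=(1-q^m)/(1-q)$. $\Phi_n(q)$ denotes the $n$-th cyclotomic polynomial. A congruence of rational functions modulo a polynomial $P(q)$, where the denominators are coprime to $P(q)$, means that $P(q)$ divides the numerator of the difference in lowest terms. *)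

(* Defs.v *)
From mathcomp Require Import all_boot all_order all_algebra all_field.
Set Implicit Arguments. Unset Strict Implicit. Unset Printing Implicit Defensive.
Import Order.TTheory GRing.Theory Num.Theory.
Local Open Scope ring_scope.

Definition qpoly := {poly rat}.
Definition qfrac := {fraction {poly rat}}.

Definition qq : qfrac := FracField.tofrac ('X : {poly rat}).

Definition qpow (m : int) : qfrac := qq ^ m.

Definition qpoch (a b : qfrac) (k : nat) : qfrac :=
  \prod_(i < k) (1 - a * b ^+ i).

Definition qint (m : int) : qfrac := (1 - qpow m) / (1 - qq).

Definition Phi (n : nat) : qpoly := map_poly intr 'Phi_n.

Definition cong0 (x : qfrac) (P : qpoly) : Prop :=
  exists a b : qpoly, [/\ coprimep b P, P %| a & x = FracField.tofrac a / FracField.tofrac b].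

(* Main.v *)
(** Put Q = q^d, u = q^r, t = q^n, d = 2h + 2 and b = u t^(-h), c = Q t^h. Since
    (1 - x t)^h (1 - x t^(-h)) agrees with (1 - x)^(h+1) modulo (1 - t)^2, one
    may replace (u;Q)_k^(h+1) by (u t;Q)_k^h (b;Q)_k and (Q;Q)_k^(h+1) by
    (Q/t;Q)_k^h (c;Q)_k.  With n + r = d (m + 1) we have u t = Q^(m+1), so
    (u;Q)_k (u t;Q)_k / ((Q;Q)_k (Q/t;Q)_k) is, up to a constant, Q^(mk) times a
    polynomial of degree m in y_k = Q^(-k) + u Q^k, and the sum becomes
    sum_k (1 - u Q^(2k)) (u,b;Q)_k / (Q,c;Q)_k b^(-k) P(y_k), deg P = h m.
    Expanding P in the Newton basis prod_(j < s) (y - y_j) with s <= h m < M,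
    where r + d M = (d - 1) n, each resulting sum telescopes to a multiple of
    (u;Q)_n (b;Q)_n, and both of these factors vanish modulo Phi_n. *)
Require Import Defs.
From mathcomp Require Import all_boot all_order all_algebra all_field.
From mathcomp Require Import ring zify.
Import Order.TTheory GRing.Theory Num.Theory.
Local Open Scope ring_scope.
Set Implicit Arguments. Unset Strict Implicit. Unset Printing Implicit Defensive.

Local Notation tofrac := (@FracField.tofrac {poly rat}).

(** * Integer powers of q in the fraction field *)

Lemma qq_neq0 : qq != 0.
Proof. by rewrite tofrac_eq0 polyX_eq0. Qed.

Lemma qpowD i j : qpow (i + j) = qpow i * qpow j.
Proof. exact: (expfzDr _ _ qq_neq0). Qed.

Lemma qpow_neq0 i : qpow i != 0.
Proof. exact: (expfz_neq0 _ qq_neq0). Qed.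

Lemma qpowX i k : qpow i ^+ k = qpow (i * k%:Z).
Proof. by rewrite /qpow exprnP exprz_exp. Qed.

Lemma qpowN i : qpow (- i) = (qpow i)^-1.
Proof. by rewrite /qpow invr_expz. Qed.

Lemma qpow_nat (k : nat) : qpow k%:Z = tofrac 'X^k.
Proof. by rewrite /qpow /qq -exprnP -tofracXn. Qed.

(** * Valuation at the cyclotomic polynomial *)

Section Valuation.
Variable n : nat.
Hypothesis n_gt1 : (1 < n)%N.
Notation F := (Phi n).

(** [vge j x]: the Phi_n-adic valuation of [x] is at least [j]. *)
Definition vge (j : nat) (x : qfrac) : Prop :=
  exists a b : {poly rat}, coprimep b F /\ x = tofrac (F ^+ j * a) / tofrac b.

Lemma root_Phi_prim (x : algC) :
  root (map_poly ratr F) x -> n.-primitive_root x.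
Proof.
have [z zP] := C_prim_root_exists (ltnW n_gt1).
rewrite -(root_cyclotomic zP) -(Cintr_Cyclotomic zP) /F -map_poly_comp.
by congr (root _ _); apply: eq_map_poly => y /=; rewrite ratr_int.
Qed.

(** Over [algC] coprimality means having no common root, and every root of [F] there is a primitive
    n-th root of unity. *)
Lemma coprimep_Phi (b : {poly rat}) :
  (forall z : algC, n.-primitive_root z -> (map_poly ratr b).[z] != 0) ->
  coprimep b F.
Proof.
move=> bP; rewrite coprimep_sym -(coprimep_map (ratr : {rmorphism rat -> algC})).
by apply/Pdiv.ClosedField.coprimepP => x /root_Phi_prim/bP.
Qed.

Lemma coprimep_PhiX : coprimep 'X F.
Proof.
apply: coprimep_Phi => z zP; rewrite map_polyX hornerX.
by rewrite (prim_root_eq0 zP) -lt0n ltnW.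
Qed.

Lemma coprimep_Phi_subXn (i : nat) : ~~ (n %| i)%N -> coprimep (1 - 'X^i) F.
Proof.
move=> ndiv; apply: coprimep_Phi => z zP.
rewrite rmorphB rmorph1 /= map_polyXn !hornerE subr_eq0 eq_sym.
by rewrite -(prim_order_dvd zP).
Qed.

(** If [b] were 0, coprimality would make [F] constant, but its degree is [totient n], which is
    positive. *)
Lemma tofrac_coprime_neq0 (b : {poly rat}) : coprimep b F -> tofrac b != 0.
Proof.
rewrite tofrac_eq0; apply: contraTneq => ->.
rewrite coprime0p -size_poly_eq1 size_map_inj_poly ?mulr0z //; last exact: intr_inj.
by rewrite size_Cyclotomic eqSS -lt0n totient_gt0 ltnW.
Qed.

Lemma vgeD j x y : vge j x -> vge j y -> vge j (x + y).
Proof.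
move=> [a [b [cb ->]]] [a' [b' [cb' ->]]].
exists (a * b' + a' * b), (b * b'); split; first by rewrite coprimepMl cb.
rewrite addf_div ?tofrac_coprime_neq0 // -!tofracM -tofracD.
by congr (tofrac _ / _); ring.
Qed.

Lemma vgeM i j x y : vge i x -> vge j y -> vge (i + j) (x * y).
Proof.
move=> [a [b [cb ->]]] [a' [b' [cb' ->]]].
exists (a * a'), (b * b'); split; first by rewrite coprimepMl cb.
by rewrite mulf_div -!tofracM exprD mulrACA.
Qed.

Lemma vge_tofrac (p : {poly rat}) : vge 0 (tofrac p).
Proof. by exists p, 1; rewrite coprime1p mul1r tofrac1 divr1. Qed.

Lemma vge1 : vge 0 1. Proof. exact: (vge_tofrac 1). Qed.

Lemma vge0 j : vge j 0.
Proof. by exists 0, 1; rewrite coprime1p mulr0 tofrac0 mul0r. Qed.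

Lemma vgeN j x : vge j x -> vge j (- x).
Proof. by move=> [a [b [cb ->]]]; exists (- a), b; rewrite mulrN tofracN mulNr. Qed.

Lemma vgeB j x y : vge j x -> vge j y -> vge j (x - y).
Proof. by move=> vx vy; apply/vgeD/vgeN. Qed.

Lemma vgeMl j x y : vge 0 x -> vge j y -> vge j (x * y).
Proof. exact: (@vgeM 0). Qed.

Lemma vgeMr j x y : vge j x -> vge 0 y -> vge j (x * y).
Proof. by rewrite mulrC => vx vy; apply: vgeMl. Qed.

Lemma vge_sum j I (s : seq I) (f : I -> qfrac) :
  (forall i, vge j (f i)) -> vge j (\sum_(i <- s) f i).
Proof. by move=> vf; apply: big_ind => //; [apply: vge0 | apply: vgeD]. Qed.

Lemma vge_prod I (s : seq I) (P : pred I) (f : I -> qfrac) :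
  (forall i, P i -> vge 0 (f i)) -> vge 0 (\prod_(i <- s | P i) f i).
Proof. by move=> vf; apply: big_ind => //; [apply: vge1 | apply: (@vgeM 0 0)]. Qed.

Lemma vgeX x k : vge 0 x -> vge 0 (x ^+ k).
Proof. by move=> vx; elim: k => [|k IH]; [exact: vge1 | rewrite exprS; exact: vgeMl]. Qed.

Lemma vge_Vtofrac (b : {poly rat}) : coprimep b F -> vge 0 (tofrac b)^-1.
Proof. by move=> cb; exists 1, b; rewrite mulr1 tofrac1 div1r. Qed.

Lemma vge_qpow i : vge 0 (qpow i).
Proof.
case: (intP i) => [|k|k]; first exact: vge1.
  by rewrite qpow_nat; apply: vge_tofrac.
rewrite qpowN qpow_nat; apply: vge_Vtofrac.
exact/coprimep_expl/coprimep_PhiX.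
Qed.

Lemma vge_1Bqpow i : vge 0 (1 - qpow i).
Proof. exact/vgeB/vge_qpow/vge1. Qed.

Lemma qpowN_sub1 i : 1 - qpow (- i) = - qpow (- i) * (1 - qpow i).
Proof. by rewrite qpowN mulNr mulrBr mulr1 mulVf ?qpow_neq0 // opprB. Qed.

Lemma vge_V1Bqpow i : ~~ (n%:Z %| i)%Z -> vge 0 (1 - qpow i)^-1.
Proof.
suff nat_case (k : nat) : ~~ (n %| k)%N -> vge 0 (1 - qpow k%:Z)^-1.
  rewrite dvdzE /=.
  case: (intP i) => [|k|k]; [exact: (nat_case 0%N) | exact: nat_case|].
  rewrite abszN qpowN_sub1 => /nat_case vk.
  by rewrite invfM invrN -qpowN opprK; apply/vgeMl/vk/vgeN/vge_qpow.
move=> ndiv; rewrite qpow_nat -tofrac1 -tofracB.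
exact/vge_Vtofrac/coprimep_Phi_subXn.
Qed.

Lemma qpow_1B_neq0 i : ~~ (n%:Z %| i)%Z -> 1 - qpow i != 0.
Proof.
rewrite dvdzE /=; have nat_case (k : nat) : ~~ (n %| k)%N -> 1 - qpow k%:Z != 0.
  move=> ndiv; rewrite qpow_nat -tofrac1 -tofracB.
  exact/tofrac_coprime_neq0/coprimep_Phi_subXn.
case: (intP i) => [|k|k]; [exact: (nat_case 0%N) | exact: nat_case|].
rewrite abszN qpowN_sub1 => /nat_case ?.
by rewrite mulf_neq0 ?oppr_eq0 ?qpow_neq0.
Qed.

(** ['X^n - 1] is the product of the cyclotomic polynomials over the divisors of n, and 1 - q^n
    divides 1 - q^(nk). *)
Lemma vge_1Bqpow_mul i : vge 1 (1 - qpow (n%:Z * i)).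
Proof.
have FXn : F %| 1 - 'X^n.
  rewrite -dvdpNr opprB.
  have := congr1 (map_poly (intr : int -> rat)) (prod_Cyclotomic (ltnW n_gt1)).
  rewrite rmorphB /= map_polyXn rmorph1 => <-.
  rewrite (bigD1_seq n) ?divisors_uniq -?dvdn_divisors //=; last exact: ltnW.
  by rewrite rmorphM /= dvdp_mulr.
suff nat_case (k : nat) : vge 1 (1 - qpow (n%:Z * k%:Z)).
  case: (intP i) => [|k|k]; [exact: (nat_case 0%N) | exact: nat_case|].
  by rewrite mulrN qpowN_sub1; apply/vgeMl/nat_case/vgeN/vge_qpow.
rewrite -qpowX -opprB subrX1; apply/vgeN/vgeMr; last first.
  by apply: vge_sum => j; apply/vgeX/vge_qpow.
have /dvdpP[p pE] := FXn.
exists (- p), 1; rewrite coprime1p tofrac1 divr1; split=> //.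
by rewrite expr1 mulrN mulrC -pE opprB tofracB tofrac1 qpow_nat.
Qed.

Lemma vge_cong0 j x : vge j x -> cong0 x (F ^+ j).
Proof.
move=> [a [b [cb ->]]]; exists (F ^+ j * a), b.
by split; [exact: coprimep_expr | exact: dvdp_mulr |].
Qed.

End Valuation.

(** * Shifted factorials and telescoping in the Newton basis *)

Section Telescope.
Variables (K : fieldType) (Q u : K).
Hypothesis Q_neq0 : Q != 0.

Definition poch (a : K) (k : nat) : K := \prod_(i < k) (1 - a * Q ^+ i).

Lemma poch0 a : poch a 0 = 1. Proof. exact: big_ord0. Qed.

Lemma pochS a k : poch a k.+1 = poch a k * (1 - a * Q ^+ k).
Proof. exact: big_ord_recr. Qed.

Lemma pochD a m k : poch a (m + k) = poch a m * poch (a * Q ^+ m) k.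
Proof.
elim: k => [|k IH]; first by rewrite addn0 poch0 mulr1.
by rewrite addnS !pochS IH exprD; ring.
Qed.

(** Cross-multiplied, both sides are (a;Q)_(m+k). This turns a quotient of length k into one of
    fixed length m, polynomial in Q^k. *)
Lemma poch_ratio a m k : poch a k != 0 -> poch a m != 0 ->
  poch (a * Q ^+ m) k / poch a k = poch (a * Q ^+ k) m / poch a m.
Proof.
move=> ak am; apply/eqP; rewrite eqr_div //; apply/eqP.
by rewrite mulrC -pochD mulrC addnC mulrC pochD mulrC.
Qed.

Definition ynode (k : nat) : K := Q ^- k + u * Q ^+ k.

Lemma ynodeB k j : ynode k - ynode j =
  Q ^- k * (1 - Q ^+ k / Q ^+ j) * (1 - u * Q ^+ k * Q ^+ j).
Proof.
have Qk : Q ^+ k != 0 by rewrite expf_neq0.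
have Qj : Q ^+ j != 0 by rewrite expf_neq0.
by rewrite /ynode; field; rewrite Qj Qk.
Qed.

Definition newton (s k : nat) : K := \prod_(j < s) (ynode k - ynode j).

Lemma newtonS s k : newton s.+1 k = newton s k * (ynode k - ynode s).
Proof. exact: big_ord_recr. Qed.

(** By [ynodeB] the values of [newton s] are products of consecutive factors, so all but the extreme
    ones cancel between N and N + 1. Factors that may vanish are kept off the denominators. *)
Lemma newton_ratio s N :
  newton s N.+1 * (1 - Q ^+ N.+1 / Q ^+ s) * Q ^+ s * (1 - u * Q ^+ N)
  = newton s N * (1 - Q ^+ N.+1) * (1 - u * Q ^+ N * Q ^+ s).
Proof.
elim: s => [|s IH]; first by rewrite /newton !big_ord0 expr0 divr1; ring.
have Qs : Q ^+ s != 0 by rewrite expf_neq0.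
have QN : Q ^+ N != 0 by rewrite expf_neq0.
rewrite !newtonS !ynodeB.
transitivity (newton s N.+1 * (1 - Q ^+ N.+1 / Q ^+ s) * Q ^+ s * (1 - u * Q ^+ N)
  * (Q ^- N * (1 - Q ^+ N / Q ^+ s) * (1 - u * Q ^+ N.+1 * Q ^+ s))).
  by rewrite !exprS; field; rewrite ?Q_neq0 ?Qs ?QN.
by rewrite IH !exprS; field; rewrite ?Qs ?QN ?Q_neq0.
Qed.

Variables b c : K.
Hypotheses (b_neq0 : b != 0) (bcE : b * c = u * Q).

(** With c = uQ/b this is the weight of a very-well-poised basic hypergeometric series, without its
    factor 1 - u Q^(2k). *)
Definition vwp (k : nat) : K :=
  poch u k * poch b k / (poch Q k * poch c k) * b ^- k.

Lemma vwp_telescope s N :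
  poch Q N != 0 -> poch c N != 0 ->
  (1 - b * Q ^+ s) *
    (\sum_(k < N.+1) (1 - u * Q ^+ (2 * k)) * vwp k * newton s k)
  = vwp N * newton s N * (1 - u * Q ^+ N * Q ^+ s) * (1 - b * Q ^+ N).
Proof.
elim: N => [|N IH].
  move=> _ _; rewrite big_ord_recr big_ord0 /= add0r muln0.
  (* For positive [s] both sides vanish at N = 0, since y_0 is itself a node. *)
  case: s => [|s]; first by rewrite !expr0; ring.
  rewrite [newton _ _]big_ord_recl /= subrr mul0r !mulr0 !mul0r //.
rewrite !pochS !mulf_eq0 !negb_or => /andP[QN QN1] /andP[cN cN1].
rewrite big_ord_recr mulrDr IH //=.
(* Ratio of consecutive weights; c = uQ/b turns the new factor of (c;Q)_(N+1) into b - u Q^(N+1). *)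
have vS : vwp N.+1 * (1 - Q ^+ N.+1) * (b - u * Q ^+ N.+1)
          = vwp N * (1 - u * Q ^+ N) * (1 - b * Q ^+ N).
  rewrite /vwp !pochS !exprS.
  have -> : b - u * (Q * Q ^+ N) = b * (1 - c * Q ^+ N).
    by rewrite mulrBr mulr1 !mulrA bcE.
  by field; rewrite QN cN cN1 QN1 b_neq0 expf_neq0.
have QN1' : 1 - Q ^+ N.+1 != 0 by rewrite exprS.
apply: (mulfI QN1').
rewrite mulrDr.
have -> : (1 - Q ^+ N.+1) *
    (vwp N * newton s N * (1 - u * Q ^+ N * Q ^+ s) * (1 - b * Q ^+ N))
  = (vwp N * (1 - u * Q ^+ N) * (1 - b * Q ^+ N)) *
    (newton s N.+1 * (1 - Q ^+ N.+1 / Q ^+ s) * Q ^+ s).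
  transitivity (vwp N * (1 - b * Q ^+ N) *
    (newton s N * (1 - Q ^+ N.+1) * (1 - u * Q ^+ N * Q ^+ s))); first by ring.
  by rewrite -newton_ratio; ring.
rewrite -vS mul2n -addnn exprD.
by field; rewrite expf_neq0.
Qed.

(** The factors 1 - u Q^(N+j) with j <= s are regrouped by splitting off j = 0 instead of j = s. The
    factor split off completes (u;Q)_N to (u;Q)_(N+1) in the telescoped value. *)
Lemma newton_mul_next s N :
  newton s N * (1 - u * Q ^+ N * Q ^+ s) = (1 - u * Q ^+ N) *
  \prod_(j < s) (Q ^- N * (1 - Q ^+ N / Q ^+ j) * (1 - u * Q ^+ N * Q ^+ j.+1)).
Proof.
elim: s => [|s IH]; first by rewrite /newton !big_ord0 expr0; ring.
by rewrite newtonS ynodeB big_ord_recr /= [RHS]mulrA -IH; ring.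
Qed.

End Telescope.

(** After reversing the second product, 1 - Q^(k+i+1) meets 1 - u Q^(k-i-1), and their product is
    Q^k times a linear polynomial in y_k. *)
Lemma poch_pair (K : fieldType) (Q u a : K) (m k : nat) :
  Q != 0 -> a * Q ^+ m = u ->
  poch Q (Q * Q ^+ k) m * poch Q (a * Q ^+ k) m =
  Q ^+ (k * m) * \prod_(i < m) (ynode Q u k - (Q ^+ i.+1 + u * Q ^- i.+1)).
Proof.
move=> Q0 aE.
rewrite [X in _ * X](reindex_inj rev_ord_inj) /= -big_split /=.
have -> : Q ^+ (k * m) = \prod_(i < m) Q ^+ k.
  by rewrite prodr_const card_ord exprM.
rewrite -big_split /=.
apply: eq_bigr => i _; rewrite -aE.
have -> : Q ^+ m = Q ^+ (m - i.+1) * Q ^+ i.+1 by rewrite -exprD subnK.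
have Qk : Q ^+ k != 0 by rewrite expf_neq0.
have Qi : Q ^+ i != 0 by rewrite expf_neq0.
by rewrite /ynode !exprS; field; rewrite ?Qk ?Qi ?Q0.
Qed.

(** Writing y - x = (y - z) + (z - x) trades an arbitrary root x for the next Newton node z, plus a
    term of lower degree. *)
Lemma newton_exchange (K : comPzRingType) (w p y z x v : K) :
  w * p * ((y - x) * v) = w * (p * (y - z)) * v + (z - x) * (w * p * v).
Proof. by ring. Qed.

Lemma ndvdz_mul (n d i : int) : coprimez n d -> 0 < i < n -> ~~ (n %| d * i)%Z.
Proof.
move=> cop /andP[i0 ltin]; rewrite Gauss_dvdzr //.
apply/negP => /dvdzP[j jE]; subst i.
have j0 : 0 < j by nia.
nia.
Qed.

(** * Valuation of the telescoped sums *)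

Section Progression.
Variables (n : nat) (d r : int) (M : nat).
Hypothesis n_gt1 : (1 < n)%N.
Hypothesis coprime_nd : coprimez n%:Z d.
Hypothesis dvdM : (n%:Z %| r + d * M%:Z)%Z.
Hypothesis ltMn : (M < n)%N.

Local Notation Q := (qpow d).
Local Notation u := (qpow r).

Lemma qpowMX a k : qpow a * Q ^+ k = qpow (a + d * k%:Z).
Proof. by rewrite qpowX -qpowD. Qed.

Lemma vge_poch a k : vge n 0 (poch Q (qpow a) k).
Proof. by apply: vge_prod => // i _; rewrite qpowMX; apply: vge_1Bqpow. Qed.

Lemma vge_Vpoch a k : (forall i, (i < k)%N -> ~~ (n%:Z %| a + d * i%:Z)%Z) ->
  vge n 0 (poch Q (qpow a) k)^-1.
Proof.
move=> ndiv; rewrite /poch -prodfV; apply: vge_prod => // i _; rewrite qpowMX.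
exact/vge_V1Bqpow/ndiv.
Qed.

Lemma poch_neq0 a k : (forall i, (i < k)%N -> ~~ (n%:Z %| a + d * i%:Z)%Z) ->
  poch Q (qpow a) k != 0.
Proof.
move=> ndiv; apply/prodf_neq0 => i _; rewrite qpowMX.
exact/(qpow_1B_neq0 n_gt1)/ndiv.
Qed.

Lemma vge1_poch a k i : (i < k)%N -> (n%:Z %| a + d * i%:Z)%Z ->
  vge n 1 (poch Q (qpow a) k).
Proof.
move=> ltik /dvdzP[j jE]; rewrite /poch (bigD1 (Ordinal ltik)) //=.
apply: vgeMr => //; first by rewrite qpowMX jE mulrC; apply: vge_1Bqpow_mul.
by apply: vge_prod => // l _; rewrite qpowMX; apply: vge_1Bqpow.
Qed.

Variables (beta gamma : int).
Hypothesis bgE : beta + gamma = r + d.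
Hypothesis dvdb : (n%:Z %| beta - r)%Z.

(** Induction on [cs]: each root is exchanged for the node y_s, which never raises [s + size cs].
    Once [cs] is empty the sum telescopes, and s < M makes the divisor 1 - b Q^s a unit at
    [Phi n]. *)
Lemma vge_newton_sum (cs : seq qfrac) (s : nat) :
  (forall x, x \in cs -> vge n 0 x) -> (s + size cs < M)%N ->
  vge n 2 (\sum_(k < n) (1 - u * Q ^+ (2 * k))
             * vwp Q u (qpow beta) (qpow gamma) k * newton Q u s k
             * \prod_(x <- cs) (ynode Q u k - x)).
Proof.
have ndivQ i : (i < n.-1)%N -> ~~ (n%:Z %| d + d * i%:Z)%Z.
  move=> lti; have -> : d + d * i%:Z = d * i.+1%:Z by lia.
  by apply: (ndvdz_mul coprime_nd); lia.
have ndivc i : (i < n.-1)%N -> ~~ (n%:Z %| gamma + d * i%:Z)%Z.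
  move=> lti.
  have -> : gamma + d * i%:Z = (d + d * i%:Z) - (beta - r) by lia.
  by rewrite dvdzE -dvdzE (rpredBr _ dvdb) ndivQ.
have vy k : vge n 0 (ynode Q u k).
  rewrite /ynode -exprVn -qpowN !qpowX -qpowD.
  by apply: vgeD => //; apply: vge_qpow.
elim: cs s => [|x cs IH] s vcs lts; last first.
  have vcs' y : y \in cs -> vge n 0 y by move=> ycs; apply: vcs; rewrite inE ycs orbT.
  under eq_bigr => k _.
    rewrite big_cons.
    rewrite (newton_exchange _ _ _ (ynode Q u s)) -newtonS.
    over.
  rewrite big_split -big_distrr /=.
  apply: vgeD => //; first by apply: IH => //; rewrite addSn -addnS.
  apply: vgeMl => //; last by apply: IH => //; apply: leq_ltn_trans lts; rewrite leq_add2l leqnSn.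
  by apply: vgeB => //; apply: vcs; rewrite inE eqxx.
under eq_bigr => k _ do rewrite big_nil mulr1.
rewrite addn0 in lts.
have nE : n = n.-1.+1 by rewrite prednK // ltnW.
(* Modulo n, beta + d s is congruent to - d (M - s), where 0 < M - s < n and d is prime to n. *)
have bs : ~~ (n%:Z %| beta + d * s%:Z)%Z.
  have -> : beta + d * s%:Z = (beta - r) + (r + d * M%:Z) - d * (M - s)%N%:Z by lia.
  by rewrite rpredBl; [apply: (ndvdz_mul coprime_nd); lia | exact: rpredD].
have bs0 : 1 - qpow beta * Q ^+ s != 0 by rewrite qpowMX; apply: qpow_1B_neq0 bs.
have bcE : qpow beta * qpow gamma = u * Q by rewrite -!qpowD bgE.
have := vwp_telescope (qpow_neq0 d) (qpow_neq0 beta) bcE s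
  (poch_neq0 ndivQ) (poch_neq0 ndivc).
rewrite -nE => /(canRL (mulKf bs0)) ->.
rewrite -[vwp _ _ _ _ _ * _ * _]mulrA newton_mul_next ?qpow_neq0 //.
set z := \prod_(j < s) _.
(* The boundary factors extend the numerators to length n, so that they reach index [M], while the
   denominators keep length n - 1 and stay units. *)
have -> : (1 - qpow beta * Q ^+ s)^-1 * (vwp Q u (qpow beta) (qpow gamma) n.-1 *
   ((1 - u * Q ^+ n.-1) * z) * (1 - qpow beta * Q ^+ n.-1)) =
   (poch Q u n * poch Q (qpow beta) n) * ((1 - qpow beta * Q ^+ s)^-1 *
   ((poch Q Q n.-1)^-1 * (poch Q (qpow gamma) n.-1)^-1 * qpow beta ^- n.-1 * z)).
  rewrite [in RHS]nE !pochS /vwp invfM.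
  move: (poch Q u _) (poch Q (qpow beta) _) (poch Q _ _)^-1 (poch Q _ _)^-1 (_ ^- _)
   (1 - _) (1 - _) (1 - _)^-1 => x1 x2 x3 x4 x5 x6 x7 x8.
  by ring.
apply: vgeMr => //.
  apply: (@vgeM n 1 1); apply: (@vge1_poch _ _ M) => //.
  have -> : beta + d * M%:Z = (beta - r) + (r + d * M%:Z) by lia.
  exact: rpredD.
rewrite qpowMX; apply: vgeMl => //; first exact: vge_V1Bqpow.
apply: vgeMr => //; last first.
  apply: vge_prod => // j _; rewrite -!exprVn -!qpowN !qpowX -!qpowD.
  apply: vgeMl => //; last by apply: vge_1Bqpow.
  by apply: vgeMl => //; [apply: vge_qpow | apply: vge_1Bqpow].
apply: vgeMr => //; last by rewrite -exprVn -qpowN qpowX; apply: vge_qpow.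
by apply: vgeMl => //; apply: vge_Vpoch.
Qed.

End Progression.

(** * Perturbation of powers modulo the square of the cyclotomic polynomial *)

Section Perturbation.
Variables (n : nat) (d : int).
Hypothesis n_gt1 : (1 < n)%N.
Local Notation Q := (qpow d).

Lemma perturb_step (K : comPzRingType) (p x t z w : K) :
  w * t = z ->
  p * (1 - x * t) * (1 - x * w) =
  p * (1 - x * z) * (1 - x) + p * x * ((1 - t) * (1 - w)).
Proof. by move=> <-; ring. Qed.

(** With t = q^(ni), each induction step replaces the pair t, t^(-h-1) by 1, t^(-h) through
    [perturb_step]; the error contains (1 - t)(1 - t^(-h-1)), of valuation at least 2. *)
Lemma vge2_perturb x (i : int) h : vge n 0 x ->
  vge n 2 ((1 - x * qpow (n%:Z * i)) ^+ h * (1 - x * qpow (n%:Z * (- i * h%:Z)))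
           - (1 - x) ^+ h.+1).
Proof.
move=> vx; elim: h => [|h IH].
  by rewrite !mulr0 mul1r mulr1 expr1 subrr; apply: vge0.
rewrite exprSr (@perturb_step _ _ _ _ (qpow (n%:Z * (- i * h%:Z)))); last first.
  by rewrite -qpowD; congr qpow; rewrite intS; ring.
rewrite addrAC [_ ^+ h.+2]exprSr -mulrBl.
have v1 : vge n 0 (1 - x) by apply: vgeB => //; apply: vge1.
apply: vgeD => //; first exact: vgeMr.
apply: vgeMl => //; last by apply: (@vgeM n 1 1); apply: vge_1Bqpow_mul.
apply: vgeMl => //; apply: vgeX; apply: vgeB => //; first exact: vge1.
by apply: vgeMl => //; apply: vge_qpow.
Qed.

Lemma subM_split (K : comPzRingType) (x y z w : K) :
  x * y - z * w = (x - z) * y + z * (y - w).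
Proof. by ring. Qed.

Lemma vge2_poch_perturb (a i : int) h k :
  vge n 2 (poch Q (qpow (a + n%:Z * i)) k ^+ h
           * poch Q (qpow (a + n%:Z * (- i * h%:Z))) k
           - poch Q (qpow a) k ^+ h.+1).
Proof.
elim: k => [|k IH]; first by rewrite !poch0 !expr1n mulr1 subrr; apply: vge0.
rewrite !pochS !exprMn mulrACA subM_split; apply: vgeD => //.
  apply: vgeMr => //; rewrite qpowX -!qpowD.
  by apply: vgeMl; [apply/vgeX|]; apply: vge_1Bqpow.
apply: vgeMl; first by apply/vgeX/vge_poch.
have qE j : qpow (a + j) * Q ^+ k = qpow a * Q ^+ k * qpow j.
  by rewrite qpowD mulrAC.
rewrite !qE; apply: vge2_perturb.
by rewrite qpowX; apply: vgeMl => //; apply: vge_qpow.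
Qed.

Lemma divB_split (K : fieldType) (p A A' B B' : K) : B != 0 -> B' != 0 ->
  p * (A * A) / (B * B) - p * (A * A') / (B * B') =
  p * A * B^-1 * (((A - A') * B' - A' * (B - B')) * (B^-1 * B'^-1)).
Proof. by move=> B0 B'0; field; rewrite B0 B'0. Qed.

Lemma vge2_div_congr p A A' B B' : B != 0 -> B' != 0 ->
  [/\ vge n 0 p, vge n 0 A & vge n 0 A'] ->
  [/\ vge n 0 B', vge n 0 B^-1 & vge n 0 B'^-1] ->
  vge n 2 (A - A') -> vge n 2 (B - B') ->
  vge n 2 (p * (A * A) / (B * B) - p * (A * A') / (B * B')).
Proof.
move=> B0 B'0 [vp vA vA'] [vB' viB viB'] vAA vBB; rewrite (divB_split (K := qfrac) p A A' B0 B'0).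
apply: vgeMl => //; first by do 2![apply: vgeMl => //].
apply: vgeMr => //; last exact: vgeMl.
by apply: vgeB => //; [apply: vgeMr | apply: vgeMl].
Qed.

End Perturbation.

(** * Regrouping the factors of a term *)

Lemma prod_flatten_nseq (K : comPzRingType) (f : K -> K) (h : nat) (s : seq K) :
  \prod_(x <- flatten (nseq h s)) f x = (\prod_(x <- s) f x) ^+ h.
Proof.
elim: h => [|h IH]; first by rewrite big_nil.
by rewrite /= big_cat IH exprS.
Qed.

Lemma size_flatten_nseq T (h : nat) (s : seq T) :
  size (flatten (nseq h s)) = (h * size s)%N.
Proof. by elim: h => //= h IH; rewrite size_cat IH mulSn. Qed.

(** The quotient contains h copies of Xt X / (Y E), each equal to D W P; what remains is X Xb / (Y
    C), the quotient in [vwp]. The factor 1 stands for [newton] with [s = 0]. *)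
Lemma pair_factors (K : fieldType) (h : nat) (S q X Xt Xb Y E C z D W P : K) :
  Xt / Y * (X / E) = D * (W * P) ->
  S / q * (X ^+ h.+1 * (Xt ^+ h * Xb)) / (Y ^+ h.+1 * (E ^+ h * C)) * z
  = q^-1 * D ^+ h * (S * (X * Xb / (Y * C) * (W ^+ h * z)) * 1 * P ^+ h).
Proof.
move=> DE.
transitivity (q^-1 * S * (X * Xb / (Y * C)) * (Xt / Y * (X / E)) ^+ h * z).
  by rewrite !exprMn !exprVn !exprS !invfM; ring.
by rewrite DE !exprMn; ring.
Qed.

(** Stated over an abstract field: conversion on the concrete fraction field
    does not terminate in reasonable time. *)
Lemma expr_neq0 (K : fieldType) (x : K) h : x != 0 -> x ^+ h != 0.
Proof. exact: expf_neq0. Qed.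

Lemma exprM_neq0 (K : fieldType) (x y : K) h :
  x != 0 -> y != 0 -> x ^+ h * y != 0.
Proof. by move=> x0 y0; rewrite mulf_neq0 ?expf_neq0. Qed.

(** * The series for d = 2(h + 1) *)

Section Series.
Variables (n h m M : nat) (r : int).
Let d : int := (2 * h.+1)%N%:Z.
Hypothesis n_gt1 : (1 < n)%N.
Hypothesis coprime_nd : coprimez n%:Z d.
Hypothesis mE : n%:Z + r = d * m.+1%:Z.
Hypothesis MmE : (M + m.+1)%N = n.
Hypothesis hmM : (h * m < M)%N.

Local Notation Q := (qpow d).
Local Notation u := (qpow r).
Local Notation b := (qpow (r + n%:Z * (- 1 * h%:Z))).
Local Notation c := (qpow (d + n%:Z * (- - 1 * h%:Z))).
Local Notation e := (qpow (d + n%:Z * - 1)).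

Let dvdM : (n%:Z %| r + d * M%:Z)%Z.
Proof. by apply/dvdzP; exists (d - 1); rewrite -MmE; move: mE; rewrite -MmE; lia. Qed.

Let ltMn : (M < n)%N.
Proof. lia. Qed.

Let ndiv_c (l j : nat) (i : int) : (l < n)%N -> (j < l)%N ->
  ~~ (n%:Z %| d + n%:Z * i + d * j%:Z)%Z.
Proof.
move=> ltl ltj; have -> : d + n%:Z * i + d * j%:Z = d * j.+1%:Z + n%:Z * i by lia.
have nd : ~~ (n%:Z %| d * j.+1%:Z)%Z by apply: (ndvdz_mul coprime_nd); lia.
by rewrite rpredDr //; apply: dvdz_mulr.
Qed.

Let ndiv_Q (l j : nat) : (l < n)%N -> (j < l)%N -> ~~ (n%:Z %| d + d * j%:Z)%Z.
Proof. by move=> ltl /(ndiv_c 0 ltl); rewrite mulr0 addr0. Qed.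

Lemma perturbed_term k : (k < n)%N ->
  qint (2 * d * k%:Z + r) * (poch Q u k ^+ h.+1 *
      (poch Q (qpow (r + n%:Z * 1)) k ^+ h * poch Q b k))
   / (poch Q Q k ^+ h.+1 * (poch Q e k ^+ h * poch Q c k))
   * qpow (h.+1%:Z * (2 * h%:Z - r) * k%:Z)
  = (1 - qq)^-1 * ((poch Q Q m)^-1 * (poch Q e m)^-1) ^+ h *
    ((1 - u * Q ^+ (2 * k)) * vwp Q u b c k * newton Q u 0 k *
     \prod_(x <- flatten (nseq h [seq Q ^+ i.+1 + u * Q ^- i.+1 | i <- iota 0 m]))
        (ynode Q u k - x)).
Proof.
move=> ltkn.
have ltmn : (m < n)%N by lia.
have Qk0 : poch Q Q k != 0 by apply: (poch_neq0 n_gt1) => j; apply: ndiv_Q.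
have Qm0 : poch Q Q m != 0 by apply: (poch_neq0 n_gt1) => j; apply: ndiv_Q.
have ek0 : poch Q e k != 0 by apply: (poch_neq0 n_gt1) => j; apply: ndiv_c.
have em0 : poch Q e m != 0 by apply: (poch_neq0 n_gt1) => j; apply: ndiv_c.
have utE : qpow (r + n%:Z * 1) = Q * Q ^+ m.
  by rewrite qpowMX; congr qpow; move: mE; lia.
have eE : e * Q ^+ m = u by rewrite qpowMX; congr qpow; move: mE; lia.
(* Here e Q^m = u and u t = Q Q^m, so [poch_ratio] reduces both quotients to length m and
   [poch_pair] applies with a = e. *)
have ratE : (poch Q (Q * Q ^+ m) k / poch Q Q k) * (poch Q u k / poch Q e k) =
    ((poch Q Q m)^-1 * (poch Q e m)^-1) * (Q ^+ (k * m) *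
      \prod_(i < m) (ynode Q u k - (Q ^+ i.+1 + u * Q ^- i.+1))).
  rewrite -(poch_pair k (qpow_neq0 d) eE) -{1}eE.
  rewrite (poch_ratio Qk0 Qm0) (poch_ratio ek0 em0).
  by rewrite mulf_div invfM mulrC.
(* The h factors Q^(km) and the given power of q have total exponent k(hn - r), by n + r = d(m +
   1). *)
have bkE : Q ^+ (k * m) ^+ h * qpow (h.+1%:Z * (2 * h%:Z - r) * k%:Z) = b ^- k.
  rewrite -exprM -exprVn -qpowN !qpowX -qpowD; congr qpow.
  have -> : r = d * m.+1%:Z - n%:Z by move: mE; lia.
  rewrite /d !PoszM !intS; ring.
have prodE : \prod_(x <- [seq Q ^+ i.+1 + u * Q ^- i.+1 | i <- iota 0 m])
    (ynode Q u k - x) = \prod_(i < m) (ynode Q u k - (Q ^+ i.+1 + u * Q ^- i.+1)).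
  by rewrite big_map -[m in iota _ m]subn0 big_mkord.
have SE : qint (2 * d * k%:Z + r) = (1 - u * Q ^+ (2 * k)) / (1 - qq).
  rewrite /qint qpowMX; congr ((1 - qpow _) / _); lia.
rewrite prod_flatten_nseq prodE SE utE /vwp /newton big_ord0 -bkE.
exact: pair_factors ratE.
Qed.

Lemma vge2_series :
  vge n 2 (\sum_(k < n)
    qint (2 * d * k%:Z + r) * poch Q u k ^+ (2 * h.+1) / poch Q Q k ^+ (2 * h.+1)
    * qpow (h.+1%:Z * (2 * h%:Z - r) * k%:Z)).
Proof.
pose cs := flatten (nseq h [seq Q ^+ i.+1 + u * Q ^- i.+1 | i <- iota 0 m]).
pose C := (1 - qq)^-1 * ((poch Q Q m)^-1 * (poch Q e m)^-1) ^+ h.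
have vq : vge n 0 (1 - qq)^-1.
  by apply: (vge_V1Bqpow n_gt1 (i := 1)); rewrite dvdzE /= dvdn1 gtn_eqF.
have ltmn : (m < n)%N by lia.
pose g k := C * ((1 - u * Q ^+ (2 * k)) * vwp Q u b c k * newton Q u 0 k
              * \prod_(x <- cs) (ynode Q u k - x)).
(* The perturbed sum is subtracted and added back: it is handled by [vge_newton_sum], the difference
   term by term. *)
rewrite -[X in vge n 2 X](subrK (\sum_(k < n) g k)) -sumrB.
apply: vgeD => //; last first.
  rewrite -big_distrr; apply: vgeMl => //.
    apply: vgeMl => //; apply: vgeX; apply: vgeMl => //; apply: vge_Vpoch => // j.
      exact: ndiv_Q.
    exact: ndiv_c.
  apply: (vge_newton_sum n_gt1 coprime_nd dvdM ltMn).
  - by rewrite /d; ring.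
  - by rewrite addrAC subrr add0r dvdz_mulr.
  - move=> x /flattenP[s /nseqP[-> _] /mapP[i _ ->]].
    rewrite -exprVn -qpowN !qpowX -qpowD.
    by apply: vgeD => //; apply: vge_qpow.
  - by rewrite size_flatten_nseq size_map size_iota.
apply: vge_sum => // k; rewrite /g /C /cs -perturbed_term // mul2n -addnn !exprD.
rewrite ![_ / _ * qpow _]mulrAC ![_ * _ * qpow _]mulrAC.
have uE : vge n 2 (poch Q u k ^+ h.+1 -
     poch Q (qpow (r + n%:Z * 1)) k ^+ h * poch Q b k).
  by rewrite -opprB; apply/vgeN/vge2_poch_perturb.
have QE : vge n 2 (poch Q Q k ^+ h.+1 - poch Q e k ^+ h * poch Q c k).
  by rewrite -opprB; apply/vgeN/vge2_poch_perturb.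
have Qk0 : poch Q Q k != 0 by apply: (poch_neq0 n_gt1) => j; apply: ndiv_Q.
have ek0 : poch Q e k != 0 by apply: (poch_neq0 n_gt1) => j; apply: ndiv_c.
have ck0 : poch Q c k != 0 by apply: (poch_neq0 n_gt1) => j; apply: ndiv_c.
apply: (vge2_div_congr n_gt1 _ _ _ _ uE QE).
- exact: expr_neq0 Qk0.
- exact: exprM_neq0 ek0 ck0.
- split; last first.
  + by apply: vgeMl; [apply: vgeX|]; apply: vge_poch.
  + exact/vgeX/vge_poch.
  by apply: vgeMl vq; apply: vgeMl; [apply: vge_1Bqpow | apply: vge_qpow].
- split.
  + by apply: vgeMl; [apply: vgeX|]; apply: vge_poch.
  + by rewrite -exprVn; apply/vgeX/vge_Vpoch => // j; apply: ndiv_Q.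
  rewrite invfM -exprVn; apply: vgeMl; [apply: vgeX|]; apply: vge_Vpoch => // j;
  exact: ndiv_c.
Qed.

End Series.

(** * From the arithmetic hypotheses to the parameters h, m and M *)

Theorem theorem6 (d : nat) (r : int) (n : nat) :
  (4 <= d)%N -> ~~ odd d -> coprimez d%:Z r ->
  (1 < n)%N -> (n%:Z == - r %[mod d%:Z])%Z ->
  r <= n%:Z -> d%:Z - r <= n%:Z ->
  cong0 (\sum_(k < n)
           qint (2 * d%:Z * k%:Z + r)
           * (qpoch (qpow r) (qpow d%:Z) k) ^+ d
           / (qpoch (qpow d%:Z) (qpow d%:Z) k) ^+ d
           * qpow ((d%:Z * (d%:Z - r - 2) * k%:Z) %/ 2)%Z)
        (Phi n ^+ 2).
Proof.
move=> d4 deven copr n1 ncong rn drn.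
have [h dE h0] : exists2 h, d = (2 * h.+1)%N & (0 < h)%N.
  by exists (d./2.-1); lia.
have [m mE] : exists m : nat, n%:Z + r = d%:Z * m.+1%:Z.
  move: ncong; rewrite eqz_mod_dvd opprK => /dvdzP[j jE].
  (* The bound d - r <= n gives n + r >= d > 0. *)
  have j0 : 0 < j by nia.
  by exists `|j|.-1; rewrite jE mulrC; congr (_ * _); lia.
(* Since r <= n, 2(h + 1)(m + 1) = n + r is at most 2n. *)
have mn : (h.+1 * m.+1 <= n)%N by nia.
have cnd : coprimez n%:Z d%:Z.
  have -> : n%:Z = m.+1%:Z * d%:Z + - r by move: mE; lia.
  by rewrite coprimez_sym /coprimez gcdzMDl gcdzN.
(* [mn] gives hm + m + 1 <= n - h, strictly below n because h > 0, that is d >= 4. *)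
have hmM : (h * m < n - m.+1)%N by nia.
have MmE : (n - m.+1 + m.+1 = n)%N by rewrite subnK //; nia.
subst d.
have := vge_cong0 (vge2_series n1 cnd mE MmE hmM).
congr cong0; apply: eq_bigr => k _; congr (_ * qpow _).
have -> : (2 * h.+1)%N%:Z * ((2 * h.+1)%N%:Z - r - 2) * k%:Z
  = h.+1%:Z * (2 * h%:Z - r) * k%:Z * 2.
  have -> : (2 * h.+1)%N%:Z = 2 + 2 * h%:Z by lia.
  have -> : h.+1%:Z = 1 + h%:Z by lia.
  by ring.
by rewrite mulzK.
Qed.
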